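(* Let $R$ be a Gaussian ring whose additive group is torsion-free. Then $\omega_{R[X]}(I[X])=\omega_R(I)$ for every ideal $I$ of $R$.
   Context: All rings are commutative with identity $1\neq 0$. For $f\in R[X]$, $c(f)$ denotes the ideal of $R$ generated by the coefficients of $f$. The ring $R$ is called Gaussian if $c(fg)=c(f)c(g)$ for all $f,g\in R[X]$. For an ideal $I$ of $R$, $I[X]$ denotes the ideal of $R[X]$ consisting of the polynomials all of whose coefficients lie in $I$. For a positive integer $n$, a proper ideal $I$ of a ring $R$ is an $n$-absorbing ideal of $R$ if whenever $x_1\cdots x_{n+1}\in I$ for $x_1,\ldots,x_{n+1}\in R$, then there are $n$ of the $x_i$'s whose product is in $I$. For a proper ideal $I$ of $R$, $\omega_R(I)=\min\{n\geq 1 : I \text{ is an } n\text{-absorbing ideal of } R\}$, with $\omega_R(I)=\infty$ if $I$ is not $n$-absorbing for any positive integer $n$; moreover $\omega_R(R)=0$. *)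

(* Defs.v *)
(* MathComp, with sets of ring elements as classical (Prop-valued) sets, so that
   ideals are arbitrary and not only boolean (decidable) ones. *)
From HB Require Import structures.
From mathcomp Require Import all_boot all_order all_algebra.
From mathcomp Require Import boolp classical_sets.

Set Implicit Arguments.
Unset Strict Implicit.
Unset Printing Implicit Defensive.

Import GRing.Theory.
Local Open Scope classical_set_scope.
Local Open Scope ring_scope.

(* The unit ideal [set: R] is allowed, unlike with MathComp's idealr_closed. *)
Definition is_ideal (R : comNzRingType) (I : set R) : Prop :=
  [/\ I 0,
      forall x y : R, I x -> I y -> I (x + y)
    & forall a x : R, I x -> I (a * x)].

Definition ideal_gen (R : comNzRingType) (S : set R) : set R :=
  smallest (@is_ideal R) S.

Definition ideal_mul (R : comNzRingType) (I J : set R) : set R :=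
  ideal_gen [set z : R | exists x y : R, [/\ I x, J y & z = x * y]].

(* Coefficients beyond the degree are 0, which does not change the ideal. *)
Definition content (R : comNzRingType) (f : {poly R}) : set R :=
  ideal_gen [set a : R | exists i : nat, a = f`_i].

Definition gaussian (R : comNzRingType) : Prop :=
  forall f g : {poly R}, content (f * g) = ideal_mul (content f) (content g).

Definition torsion_free (V : zmodType) : Prop :=
  forall (n : nat) (x : V), (0 < n)%N -> x *+ n = 0 -> x = 0.

(* The ideal I[X] of R[X]. *)
Definition poly_ideal (R : comNzRingType) (I : set R) : set {poly R} :=
  [set f : {poly R} | forall i : nat, I f`_i].

(* The set A selects the indices of the n factors, among the n + 1 given ones,
   whose product lies in I. *)
Definition n_absorbing (R : comNzRingType) (n : nat) (I : set R) : Prop :=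
  [/\ is_ideal I, I <> [set: R], (0 < n)%N
    & forall x : 'I_n.+1 -> R, I (\prod_(i < n.+1) x i) ->
        exists A : {set 'I_n.+1}, #|A| = n /\ I (\prod_(i in A) x i)].

(* Values in the natural numbers extended with infinity: Some n stands for the
   natural number n, and None for infinity. *)
Definition omega (R : comNzRingType) (I : set R) : option nat :=
  if pselect (I = [set: R]) then Some 0%N
  else match pselect (exists n : nat, `[< n_absorbing n I >]) with
       | left ex_n => Some (ex_minn ex_n)
       | right _ => None
       end.

(* Main.v *)
(* In a Gaussian ring the content of a product of polynomials is the product of
   their contents, so the claim amounts to: if ideals J_1, ..., J_(n+1) generated by
   finite sets have their product in an n-absorbing ideal I, then so do n of them.
   Otherwise one replaces the J_k one after the other by a single element x of J_k,
   keeping all n-fold products outside I, which contradicts n-absorption.  The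
   element x has to avoid the ideals A_i = (I : product of the J_j with j <> i, k),
   i <> k, none of which contains J_k.  In the localization of a Gaussian ring at a
   prime, for all a and b one of a, b dominates the other, say (a, b)^2 = (a^2), and
   then (a, b) = (a, n) with a n = n^2 = 0.  Hence n annihilates everything dominated
   by a, and the traces on J_k of all the A_i but one form a chain.  Locally, x has
   thus to avoid two proper submodules, which Nakayama's lemma makes proper modulo
   the maximal ideal; the local choices are glued by the Chinese remainder
   theorem. *)
Require Import Defs.
From HB Require Import structures.
From mathcomp Require Import all_boot all_order all_algebra.
From mathcomp Require Import boolp classical_sets.
From mathcomp Require Import ring.

Set Implicit Arguments.
Unset Strict Implicit.
Unset Printing Implicit Defensive.

Import GRing.Theory.
Local Open Scope classical_set_scope.
Local Open Scope ring_scope.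

(** * Ideals and maximal ideals *)

Section Ideals.
Variable R : comNzRingType.
Implicit Types (I J K M T : set R) (a b c r x y z : R) (s : seq R).

Lemma ideal0 I : is_ideal I -> I 0.
Proof. by case. Qed.

Lemma idealD I x y : is_ideal I -> I x -> I y -> I (x + y).
Proof. by case=> _ addI _; apply: addI. Qed.

Lemma idealMl I a x : is_ideal I -> I x -> I (a * x).
Proof. by case=> _ _ mulI; apply: mulI. Qed.

Lemma idealMr I a x : is_ideal I -> I x -> I (x * a).
Proof. by rewrite mulrC; apply: idealMl. Qed.

Lemma idealN I x : is_ideal I -> I x -> I (- x).
Proof. by rewrite -mulN1r; apply: idealMl. Qed.

Lemma idealB I x y : is_ideal I -> I x -> I y -> I (x - y).
Proof. by move=> idI Ix Iy; apply: idealD => //; apply: idealN. Qed.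

Lemma ideal_sum I (X : Type) (r : seq X) (P : pred X) (F : X -> R) :
  is_ideal I -> (forall i, P i -> I (F i)) -> I (\sum_(i <- r | P i) F i).
Proof.
move=> idI IF; apply: big_ind => //; first exact: ideal0.
by move=> x y; apply: idealD.
Qed.

Lemma idealT : is_ideal (setT : set R).
Proof. by []. Qed.

Lemma is_ideal_gen (S : set R) : is_ideal (ideal_gen S).
Proof.
split=> [J [idJ _]|x y Ix Iy J JS|a x Ix J JS].
- exact: ideal0.
- by apply: idealD; [case: JS|apply: Ix|apply: Iy].
- by apply: idealMl; [case: JS|apply: Ix].
Qed.

Lemma sub_ideal_gen (S : set R) x : S x -> ideal_gen S x.
Proof. exact: sub_gen_smallest. Qed.

Lemma ideal_gen_sub (S J : set R) : is_ideal J -> S `<=` J -> ideal_gen S `<=` J.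
Proof. by move=> idJ SJ; apply: smallest_sub. Qed.

Definition prime_ideal M :=
  [/\ is_ideal M, ~ M 1 & forall x y, M (x * y) -> M x \/ M y].

Definition maximal_ideal M :=
  [/\ is_ideal M, ~ M 1 & forall x, ~ M x -> exists r, M (1 - r * x)].

Lemma maximal_prime M : maximal_ideal M -> prime_ideal M.
Proof.
case=> idM M1 maxM; split=> // x y Mxy.
have [Mx|/maxM[r Mr]] := pselect (M x); [by left|right].
have -> : y = (1 - r * x) * y + r * (x * y) by ring.
by apply: idealD => //; [apply: idealMr|apply: idealMl].
Qed.

Lemma maximal_comaximal M N : maximal_ideal M -> maximal_ideal N -> M <> N ->
  exists2 p, M p & N (1 - p).
Proof.
move=> [idM M1 maxM] [idN N1 maxN] neqMN.
have [x Mx Nx] : exists2 x, M x & ~ N x.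
  apply: contrapT => noP; apply: neqMN; apply/seteqP; split=> x.
    by move=> Mx; apply: contrapT => Nx; apply: noP; exists x.
  move=> Nx; apply: contrapT => /maxM[r Mr]; apply: N1.
  have -> : 1 = (1 - r * x) + r * x by ring.
  apply: idealD => //; last exact: idealMl.
  by apply: contrapT => Nr; apply: noP; exists (1 - r * x).
by have [r Nr] := maxN x Nx; exists (r * x) => //; apply: idealMl.
Qed.

Lemma exists_maximal_ideal K : is_ideal K -> ~ K 1 ->
  exists M, maximal_ideal M /\ K `<=` M.
Proof.
move=> idK K1.
(* Zorn's lemma is applied to sets whose union with [K] is a proper ideal, so that the empty chain
   also has an admissible union. *)
pose P (X : set R) := is_ideal (X `|` K) /\ ~ (X `|` K) 1.
have [F FP totF|A [[idA A1] maxA]] := @Zorn_bigcup R P.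
  have sub X x : F X -> (X `|` K) x -> ((\bigcup_(Y in F) Y) `|` K) x.
    by move=> FX [Xx|Kx]; [left; exists X|right].
  split; last by case=> // -[X FX X1]; case: (FP X FX) => _; apply; left.
  split; first by right; apply: ideal0.
  - move=> x y [[X FX Xx]|Kx] [[Y FY Yy]|Ky].
    + have [XY|YX] := totF X Y FX FY.
        apply: (sub Y) => //; apply: idealD; first by case: (FP Y FY).
          by left; apply: XY.
        by left.
      apply: (sub X) => //; apply: idealD; first by case: (FP X FX).
        by left.
      by left; apply: YX.
    + by apply: (sub X) => //; apply: idealD; [case: (FP X FX)|left|right].
    + by apply: (sub Y) => //; apply: idealD; [case: (FP Y FY)|right|left].
    + by right; apply: idealD.
  - move=> a x [[X FX Xx]|Kx]; last by right; apply: idealMl.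
    by apply: (sub X) => //; apply: idealMl; [case: (FP X FX)|left].
exists (A `|` K); split; last by move=> x; right.
split=> // x nAx.
pose B := [set z | exists r, (A `|` K) (z - r * x)].
have KB : B `|` K = B.
  by apply/setUidPl => z Kz; exists 0; rewrite mul0r subr0; right.
have idB : is_ideal B.
  split; first by exists 0; rewrite mul0r subr0; apply: ideal0.
  - move=> y z [r Ar] [t At]; exists (r + t).
    have -> : y + z - (r + t) * x = (y - r * x) + (z - t * x) by ring.
    exact: idealD.
  - move=> a y [r Ar]; exists (a * r).
    have -> : a * y - a * r * x = a * (y - r * x) by ring.
    exact: idealMl.
have AB : A `<` B.
  split; first by move=> z Az; exists 0; rewrite mul0r subr0; left.
  move=> BA; apply: nAx; left; apply: BA.
  by exists 1; rewrite mul1r subrr; apply: ideal0.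
by apply: contrapT => nB1; apply: (maxA B AB); rewrite /P KB.
Qed.

(** * Localization at a prime ideal, Nakayama's lemma and avoidance *)

Lemma prime_notM M x y : prime_ideal M -> ~ M x -> ~ M y -> ~ M (x * y).
Proof. by case=> _ _ prM Mx My /prM[]. Qed.

(* The preimage in [R] of the extension of [I] to the localization at [M]. *)
Definition sat I M : set R := [set x | exists2 u, ~ M u & I (u * x)].

Lemma is_ideal_sat I M : is_ideal I -> prime_ideal M -> is_ideal (sat I M).
Proof.
move=> idI prM; have [idM M1 _] := prM; split.
- by exists 1 => //; rewrite mulr0; apply: ideal0.
- move=> x y [u Mu Iu] [v Mv Iv]; exists (u * v); first exact: prime_notM.
  have -> : u * v * (x + y) = v * (u * x) + u * (v * y) by ring.
  by apply: idealD => //; apply: idealMl.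
- move=> a x [u Mu Iu]; exists u => //; rewrite mulrCA; exact: idealMl.
Qed.

Lemma satK I M u x : prime_ideal M -> ~ M u -> sat I M (u * x) -> sat I M x.
Proof.
move=> prM Mu [v Mv]; rewrite mulrA => Iv.
by exists (v * u) => //; apply: prime_notM.
Qed.

Lemma sub_sat I M x : prime_ideal M -> I x -> sat I M x.
Proof. by case=> _ M1 _ Ix; exists 1 => //; rewrite mul1r. Qed.

(** For an ideal [Q] this is [Q J], with [J] the ideal generated by [s]; [Q = setT] gives [J]
    itself. *)
Fixpoint lincomb (Q : set R) (s : seq R) : set R :=
  if s is b :: s' then [set x | exists c y, [/\ Q c, lincomb Q s' y & x = c * b + y]]
  else [set 0].

Lemma is_ideal_lincomb Q s : is_ideal Q -> is_ideal (lincomb Q s).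
Proof.
move=> idQ; elim: s => [|b s IHs] /=.
  by split=> // [x y -> ->|a x ->]; rewrite ?addr0 ?mulr0.
split.
- by exists 0, 0; split; [apply: ideal0|apply: ideal0|rewrite mul0r addr0].
- move=> _ _ [c [x [Qc Lx ->]]] [d [y [Qd Ly ->]]]; exists (c + d), (x + y).
  by split; [apply: idealD|apply: idealD|ring].
- move=> a _ [c [x [Qc Lx ->]]]; exists (a * c), (a * x).
  by split; [apply: idealMl|apply: idealMl|ring].
Qed.

Local Notation span := (lincomb setT).

Lemma lincomb_span Q s x : lincomb Q s x -> span s x.
Proof.
elim: s x => //= b s IHs x [c [y [_ Ly ->]]].
by exists c, y; split=> //; apply: IHs.
Qed.

Lemma lincombMl Q s m x : is_ideal Q -> Q m -> span s x -> lincomb Q s (m * x).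
Proof.
move=> idQ Qm; elim: s x => [|b s IHs] x /=; first by move=> ->; rewrite mulr0.
move=> [c [y [_ Ly ->]]]; exists (m * c), (m * y).
by split; [apply: idealMr|apply: IHs|ring].
Qed.

Lemma span_sub s T : is_ideal T -> (forall b, b \in s -> T b) -> span s `<=` T.
Proof.
move=> idT; elim: s => [|b s IHs] sT x /=; first by move=> ->; apply: ideal0.
move=> [c [y [_ Ly ->]]]; apply: idealD => //.
  by apply: idealMl => //; apply: sT; rewrite inE eqxx.
by apply: IHs => // d sd; apply: sT; rewrite inE sd orbT.
Qed.

Lemma mem_span s b : b \in s -> span s b.
Proof.
elim: s => //= c s IHs; rewrite inE => /orP[/eqP->|/IHs sb].
  by exists 1, 0; split; [|exact: (ideal0 (is_ideal_lincomb s idealT))|rewrite mul1r addr0].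
by exists 0, b; split=> //; rewrite mul0r add0r.
Qed.

(** Generators are eliminated one by one: the coefficient [u - m0] of the first generator [b] is a
    unit at [M], and substituting for [b] leaves relations of the same kind among the others. *)
Lemma nakayama s T M : is_ideal T -> prime_ideal M ->
    (forall u x, ~ M u -> T (u * x) -> T x) ->
    (forall b, b \in s ->
       exists u m t, [/\ ~ M u, lincomb M s m, T t & u * b = m + t]) ->
  forall b, b \in s -> T b.
Proof.
move=> idT prM satT; have [idM M1 _] := prM.
elim: s => // b s IHs gen.
have [u [_ [t [Mu [m0 [m [Mm0 Lm ->]]] Tt ub]]]] := gen b (mem_head _ _).
have Mv : ~ M (u - m0).
  by move=> /idealD-/(_ m0 idM)/(_ Mm0); rewrite subrK.
have vb : (u - m0) * b = m + t by rewrite mulrBl ub; ring.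
have sT d : d \in s -> T d.
  apply: IHs => {}d sd.
  have sd' : d \in b :: s by rewrite inE sd orbT.
  have [u' [_ [t' [Mu' [m1 [m' [Mm1 Lm' ->]]] Tt' ud]]]] := gen d sd'.
  exists ((u - m0) * u'), (m1 * m + (u - m0) * m'), (m1 * t + (u - m0) * t').
  split; first exact: prime_notM.
  - have idL := is_ideal_lincomb s idM.
    by apply: idealD => //; apply: idealMl.
  - by apply: idealD => //; apply: idealMl.
  - rewrite -mulrA ud mulrDr mulrDr mulrCA vb; ring.
move=> d; rewrite inE => /orP[/eqP->|]; last exact: sT.
apply: (satT (u - m0)) => //; rewrite vb; apply: idealD => //.
by apply: (span_sub idT sT); apply: lincomb_span Lm.
Qed.

(* [avoids s M C x] says that the class of [x] in [J / M J], with [J] the ideal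
   generated by [s], lies outside the image of the intersection of [J] and [C]. *)
Definition avoids s M C : set R :=
  [set x | forall y, span s y -> lincomb M s (x - y) -> ~ C y].

(** Some generator already works: otherwise each lies in [M J + C], with [J] the span of [s], and
    Nakayama's lemma puts [J] inside [C]. *)
Lemma exists_avoids s M C : is_ideal C -> prime_ideal M ->
    (forall u x, ~ M u -> C (u * x) -> C x) -> ~ (span s `<=` C) ->
  exists2 x, span s x & avoids s M C x.
Proof.
move=> idC prM satC nsC; apply: contrapT => noP; apply: nsC.
apply: span_sub => //; apply: (nakayama idC prM satC) => b sb.
have [idM M1 _] := prM.
have /existsNP[y /not_implyP[Ly /not_implyP[Lby /contrapT Cy]]] :
    ~ avoids s M C b.
  by move=> av; apply: noP; exists b => //; apply: mem_span.
by exists 1, (b - y), y; split=> //; ring.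
Qed.

(* A group is not the union of two proper subgroups. *)
Lemma exists_avoids2 s M C D x y : is_ideal M -> is_ideal C -> is_ideal D ->
    span s x -> avoids s M C x -> span s y -> avoids s M D y ->
  exists z, [/\ span s z, avoids s M C z & avoids s M D z].
Proof.
move=> idM idC idD sx Cx sy Dy.
have idL := is_ideal_lincomb s idM; have idS := is_ideal_lincomb s idealT.
have [Dx|nDx] := pselect (avoids s M D x); first by exists x.
have [Cy|nCy] := pselect (avoids s M C y); first by exists y.
move: nDx => /existsNP[x' /not_implyP[sx' /not_implyP[Lx /contrapT Dx']]].
move: nCy => /existsNP[y' /not_implyP[sy' /not_implyP[Ly /contrapT Cy']]].
exists (x + y); split; first exact: idealD.
- move=> z sz Lz Cz; apply: (Cx (z - y')); [exact: idealB| |exact: idealB].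
  have -> : x - (z - y') = (x + y - z) - (y - y') by ring.
  exact: idealB.
- move=> z sz Lz Dz; apply: (Dy (z - x')); [exact: idealB| |exact: idealB].
  have -> : y - (z - x') = (x + y - z) - (x - x') by ring.
  exact: idealB.
Qed.

(** * Chinese remainder theorem *)

Lemma maximal_crt (Ms : seq (set R)) N : maximal_ideal N ->
    (forall M, M \in Ms -> maximal_ideal M) -> N \notin Ms ->
  exists2 e, (forall M, M \in Ms -> M e) & N (1 - e).
Proof.
move=> maxN; have [idN _ _] := maxN.
elim: Ms => [|M Ms IHs] maxMs; first by exists 1 => //; rewrite subrr; apply: ideal0.
rewrite inE negb_or => /andP[/eqP NM NMs].
have maxM : maximal_ideal M by apply: maxMs; rewrite inE eqxx.
have [|e Mse Ne] := IHs _ NMs.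
  by move=> M' MsM'; apply: maxMs; rewrite inE MsM' orbT.
have [p Mp Np] := maximal_comaximal maxM maxN (nesym NM).
exists (p * e) => [M'|].
  rewrite inE => /orP[/eqP->|MsM']; first by apply: idealMr => //; case: maxM.
  apply: idealMl; last exact: Mse.
  by case: (maxMs M'); rewrite // inE MsM' orbT.
have -> : 1 - p * e = (1 - e) + (1 - p) * e by ring.
by apply: idealD => //; apply: idealMr.
Qed.

(** The third hypothesis makes [P M] depend only on the class modulo [M J], with [J] the span of
    [s]. Hence [(1 - e) * x + e * y] behaves like [x] at the earlier ideals and like [y] at [N]. *)
Lemma crt_choice (Ms : seq (set R)) s (P : set R -> set R) :
    (forall M, M \in Ms -> maximal_ideal M) ->
    (forall M, M \in Ms -> exists2 x, span s x & P M x) ->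
    (forall M x y, M \in Ms -> span s x -> span s y -> lincomb M s (x - y) ->
       P M x -> P M y) ->
  exists2 x, span s x & forall M, M \in Ms -> P M x.
Proof.
move=> maxMs exP closeP; have idS := is_ideal_lincomb s idealT.
elim: Ms => [|N Ms IHs] in maxMs exP closeP *; first by exists 0 => //; apply: ideal0.
have inMs M : M \in Ms -> M \in N :: Ms by rewrite inE orbC => ->.
have [x sx Px] : exists2 x, span s x & forall M, M \in Ms -> P M x.
  by apply: IHs => [M /inMs/maxMs|M /inMs/exP|M x y /inMs]; last exact: closeP.
have [NMs|NMs] := boolP (N \in Ms).
  by exists x => // M; rewrite inE => /orP[/eqP->|]; apply: Px.
have maxN : maximal_ideal N by apply/maxMs/mem_head.
have [e Mse Ne] := maximal_crt maxN (fun M MsM => maxMs M (inMs M MsM)) NMs.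
have [y sy Py] := exP N (mem_head _ _).
have sz : span s ((1 - e) * x + e * y) by apply: idealD => //; apply: idealMl.
have sxy : span s (x - y) by apply: idealB.
exists ((1 - e) * x + e * y) => // M; rewrite inE => /orP[/eqP->|MsM].
  apply: (closeP N y) => //; first exact: mem_head.
  have -> : y - ((1 - e) * x + e * y) = (1 - e) * - (x - y) by ring.
  by apply: lincombMl => //; [case: maxN|apply: idealN].
apply: (closeP M x) => //; [exact: inMs| |exact: Px].
have -> : x - ((1 - e) * x + e * y) = e * (x - y) by ring.
by apply: lincombMl => //; [case: (maxMs M (inMs M MsM))|apply: Mse].
Qed.

End Ideals.

Local Notation span := (lincomb setT).

(** * Domination in the localization of a Gaussian ring *)

Section LocalGaussian.
Variables (R : comNzRingType) (gaussR : gaussian R).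
Implicit Types (I J M : set R) (a b c d x y z : R).

Lemma gaussian_content_mul (f g : {poly R}) J x y : is_ideal J ->
  (forall i, J (f * g)`_i) -> content f x -> content g y -> J (x * y).
Proof.
move=> idJ fgJ fx gy.
have : content (f * g) `<=` J by apply: ideal_gen_sub => // _ [i ->].
by apply; rewrite gaussR; apply: sub_ideal_gen; exists x, y.
Qed.

(** The hypotheses bear on the coefficients of [(a + b X)(c + d X)], whose content is the product of
    [(a, b)] and [(c, d)]. *)
Lemma gaussian_linear a b c d J : is_ideal J ->
    J (a * c) -> J (a * d + b * c) -> J (b * d) ->
  [/\ J (a * c), J (a * d), J (b * c) & J (b * d)].
Proof.
move=> idJ Jac Jm Jbd.
pose lin x y := x%:P + y%:P * 'X : {poly R}.
have c0 x y : content (lin x y) x.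
  by apply: sub_ideal_gen; exists 0%N; rewrite coefD coefC coefCM coefX mulr0 addr0.
have c1 x y : content (lin x y) y.
  by apply: sub_ideal_gen; exists 1%N; rewrite coefD coefC coefCM coefX mulr1 add0r.
have linM i : J (lin a b * lin c d)`_i.
  have -> : lin a b * lin c d =
      (a * c)%:P + (a * d + b * c)%:P * 'X + (b * d)%:P * 'X^2.
    by rewrite /lin !polyCD !polyCM; ring.
  rewrite !coefD !coefCM coefC coefX coefXn.
  case: i => [|[|[|i]]]; rewrite ?mulr0 ?mulr1 ?addr0 ?add0r //=.
  exact: ideal0.
by split; apply: (gaussian_content_mul idJ linM).
Qed.

Definition ideal2 x y : set R := [set z | exists r t, z = r * x + t * y].

Lemma is_ideal2 x y : is_ideal (ideal2 x y).
Proof.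
split=> [|_ _ [r [t ->]] [r' [t' ->]]|c _ [r [t ->]]].
- by exists 0, 0; ring.
- by exists (r + r'), (t + t'); ring.
- by exists (c * r), (c * t); ring.
Qed.

(* [(a, b) ^ 2 = (a ^ 2)] in the localization at [M]. *)
Definition dominates M a b := exists u s r,
  [/\ ~ M u, u * (a * b) = s * a ^+ 2 & u * b ^+ 2 = r * a ^+ 2].

Variables (M : set R) (prM : prime_ideal M).
Local Notation dom := (dominates M).

(** All coefficients of [(a + b X)((r a - b) - r b X)] are multiples of [b ^ 2], hence so is
    [r a b]; the given relation times [r] then handles [a ^ 2]. *)
Lemma dominates_rel a b r t : a * b = r * a ^+ 2 + t * b ^+ 2 -> ~ M r -> dom b a.
Proof.
move=> abE Mr.
have [||||_ [y [z yE]] _ _] :=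
    @gaussian_linear a b (r * a - b) (- (r * b)) (ideal2 (b ^+ 2) 0).
  - exact: is_ideal2.
  - exists (- t), 0.
    have -> : a * (r * a - b) = r * a ^+ 2 - a * b by ring.
    rewrite abE; ring.
  - by exists (- 1), 0; ring.
  - by exists (- r), 0; ring.
have {}yE : r * (a * b) = - y * b ^+ 2.
  have -> : r * (a * b) = - (a * - (r * b)) by ring.
  rewrite yE; ring.
have raE : r * r * a ^+ 2 = (- y - r * t) * b ^+ 2.
  have -> : r * r * a ^+ 2 = r * (r * a ^+ 2 + t * b ^+ 2) - r * t * b ^+ 2 by ring.
  rewrite -abE yE; ring.
exists (r * r), (- (r * y)), (- y - r * t); split=> //; first exact: prime_notM.
have -> : r * r * (b * a) = r * (r * (a * b)) by ring.
rewrite yE; ring.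
Qed.

(* Modulo [M], the square of [(a, b)] has dimension at most 1: a relation
   [a b = r a ^ 2 + t b ^ 2] comes from [(a + b X) (a - b X)], and another one from
   [(a + b X) ((r a - b) - r b X)] if [r] is a unit, from
   [(a + b X) (b + a X)] if [r] and [t] are not. *)
Lemma dominates_total a b : dom a b \/ dom b a.
Proof.
have [idM M1 _] := prM.
have [||||_ [r [t abE]] _ _] :=
    @gaussian_linear a b a (- b) (ideal2 (a ^+ 2) (b ^+ 2)).
  - exact: is_ideal2.
  - by exists 1, 0; ring.
  - by exists 0, 0; ring.
  - by exists 0, (- 1); ring.
have {r t abE}[r [t abE]] : exists r t, a * b = r * a ^+ 2 + t * b ^+ 2.
  exists (- r), (- t).
  have -> : a * b = - (a * - b) by ring.
  rewrite abE; ring.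
have [Mr|Mr] := pselect (M r); last by right; apply: dominates_rel abE Mr.
have [Mt|Mt] := pselect (M t); last first.
  by left; apply: (@dominates_rel _ _ t r) => //; rewrite mulrC abE addrC.
have [||||_ [x [y aE]] _ _] :=
    @gaussian_linear a b b a (ideal2 (a * b) (a ^+ 2 + b ^+ 2)).
  - exact: is_ideal2.
  - by exists 1, 0; ring.
  - by exists 0, 1; ring.
  - by exists 1, 0; ring.
(* Substituting [abE] in [aE] gives [u a ^ 2 = v b ^ 2]; as [u + v] is 1 modulo [M], one of [u], [v]
   is a unit at [M]. *)
set u := 1 - y - x * r; set v := y + x * t.
have uv : u * a ^+ 2 = v * b ^+ 2.
  have -> : u * a ^+ 2 = a * a - y * a ^+ 2 - x * r * a ^+ 2 by rewrite /u; ring.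
  rewrite aE abE /v; ring.
have [Mu|Mu] := pselect (M u).
  left; exists v, (v * r + t * u), u; split=> // [Mv|].
    apply: M1; have -> : 1 = u + v + x * r - x * t by rewrite /u /v; ring.
    by apply: idealB; [|apply: idealD; [|apply: idealD|apply: idealMl]|apply: idealMl].
  have -> : v * (a * b) = v * r * a ^+ 2 + t * (v * b ^+ 2) by rewrite abE; ring.
  rewrite -uv; ring.
right; exists u, (r * v + u * t), v; split=> //.
have -> : u * (b * a) = r * (u * a ^+ 2) + u * t * b ^+ 2.
  by rewrite (mulrC b) abE; ring.
rewrite uv; ring.
Qed.

(** Relations between squares compose. For [a c], totality allows assuming that [c] dominates [a],
    so that [a c] is locally a multiple of [c ^ 2], hence of [a ^ 2]. *)
Lemma dominates_trans a b c : dom a b -> dom b c -> dom a c.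
Proof.
move=> [u [_ [r [Mu _ uE]]]] [v [_ [t [Mv _ vE]]]].
have [//|[w [s [_ [Mw wE _]]]]] := dominates_total a c.
have cE : u * v * c ^+ 2 = t * r * a ^+ 2.
  have -> : u * v * c ^+ 2 = u * (v * c ^+ 2) by ring.
  rewrite vE; have -> : u * (t * b ^+ 2) = t * (u * b ^+ 2) by ring.
  rewrite uE; ring.
exists (w * (u * v)), (s * t * r), (w * t * r); split.
- by apply: prime_notM => //; apply: prime_notM.
- have -> : w * (u * v) * (a * c) = u * v * (w * (c * a)) by ring.
  rewrite wE; have -> : u * v * (s * c ^+ 2) = s * (u * v * c ^+ 2) by ring.
  rewrite cE; ring.
- by rewrite -mulrA cE; ring.
Qed.

Lemma dominates_decomp a b : dom a b -> exists u s n,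
  [/\ ~ M u, u * b = s * a + n, a * n = 0 & n * n = 0].
Proof.
move=> [u [s [r [Mu uE rE]]]]; exists u, s, (u * b - s * a).
have an0 : a * (u * b - s * a) = 0.
  have -> : a * (u * b - s * a) = u * (a * b) - s * a ^+ 2 by ring.
  by rewrite uE subrr.
split=> //; first by ring.
set n := u * b - s * a in an0 *.
set q := u * r - s ^+ 2.
have nE : n * n = q * a ^+ 2.
  have -> : n * n = u * (u * b ^+ 2) - s * 2%:R * (u * (a * b)) + s ^+ 2 * a ^+ 2.
    by rewrite /n; ring.
  rewrite rE uE /q; ring.
(* The product [(a + n X)(n - q a X)] is zero, which forces [n * n = 0]. *)
have [||||//] := @gaussian_linear a n n (- (q * a)) [set 0].
  - by split=> [|_ _ -> ->|c _ ->] /=; rewrite ?addr0 ?mulr0.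
  - exact: an0.
  - by rewrite nE; ring.
  - have -> : n * - (q * a) = - q * (a * n) by ring.
    by rewrite an0 mulr0.
Qed.

(** Locally [c] is [t a + m] with [m ^ 2 = 0]. Here [n] kills [a], and [n m] vanishes locally
    because one of [n], [m] dominates the other and both have square zero. *)
Lemma dominates_decomp_null a b : dom a b -> exists u s n,
  [/\ ~ M u, u * b = s * a + n &
      forall c, dom a c -> exists2 v, ~ M v & v * (n * c) = 0].
Proof.
move=> /dominates_decomp[u [s [n [Mu uE an0 nn0]]]]; exists u, s, n; split=> // c.
move=> /dominates_decomp[v [t [m [Mv vE am0 mm0]]]].
have [w Mw wE] : exists2 w, ~ M w & w * (n * m) = 0.
  have [|] := dominates_total n m => -[w [r [_ [Mw wE _]]]]; exists w => //.
    by rewrite wE expr2 nn0 mulr0.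
  by rewrite (mulrC n) wE expr2 mm0 mulr0.
exists (w * v); first exact: prime_notM.
have -> : w * v * (n * c) = w * (n * (v * c)) by ring.
rewrite vE; have -> : w * (n * (t * a + m)) = w * t * (a * n) + w * (n * m) by ring.
by rewrite an0 wE mulr0 addr0.
Qed.

End LocalGaussian.

Lemma exists_dominant (T : eqType) (le : T -> T -> Prop) (s : seq T) :
    (forall a b, le a b \/ le b a) ->
    (forall a b c, le a b -> le b c -> le a c) -> s <> [::] ->
  exists2 a, a \in s & forall b, b \in s -> le a b.
Proof.
move=> tot tr; elim: s => // b [|c s] IHs _.
  by exists b => [|d]; rewrite mem_seq1 // => /eqP ->; case: (tot b b).
have [//|a sa amax] := IHs; have [ab|ba] := tot a b.
  exists a; first by rewrite inE sa orbT.
  by move=> d; rewrite inE => /orP[/eqP->|/amax].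
exists b; first by rewrite mem_head.
move=> d; rewrite inE => /orP[/eqP->|/amax]; first by case: (tot b b).
exact: tr.
Qed.

(** * Replacing finitely generated ideals by single elements *)

Section Families.
Variables (R : comNzRingType) (T : finType).
Implicit Types (I M : set R) (x y : R) (s : T -> seq R) (b : T -> R) (i j k : T).

(** The products of such values generate the product of the ideals spanned by the lists [s j]. *)
Definition choice_of s b := forall j, b j \in s j.

Definition upd b k x : T -> R := fun j => if j == k then x else b j.

Lemma prod_upd b k x (P : pred T) : P k ->
  \prod_(j | P j) upd b k x j = x * \prod_(j | P j && (j != k)) b j.
Proof.
move=> Pk; rewrite (bigD1 k) //= /upd eqxx; congr (_ * _).
by apply: eq_bigr => j /andP[_ /negPf->].
Qed.

Lemma prod_updN b k x (P : pred T) : ~~ P k ->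
  \prod_(j | P j) upd b k x j = \prod_(j | P j) b j.
Proof.
move=> Pk; apply: eq_bigr => j Pj; rewrite /upd; case: eqP => // jk.
by rewrite -jk Pj in Pk.
Qed.

Lemma choice_upd s b k x : choice_of s b -> x \in s k -> choice_of s (upd b k x).
Proof. by move=> sb sx j; rewrite /upd; case: eqP => [->|]. Qed.

(* The ideal [I : prod_(j != i, k) (s j)], localized at [M]. *)
Definition killers I M s k i : set R :=
  [set x | forall b, choice_of s b ->
     sat I M (x * \prod_(j | (j != i) && (j != k)) b j)].

Lemma is_ideal_killers I M s k i : is_ideal I -> prime_ideal M ->
  is_ideal (killers I M s k i).
Proof.
move=> idI prM; have idS := is_ideal_sat idI prM; split.
- by move=> b sb; rewrite mul0r; apply: ideal0.
- by move=> x y Kx Ky b sb; rewrite mulrDl; apply: idealD; [|apply: Kx|apply: Ky].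
- by move=> a x Kx b sb; rewrite -mulrA; apply: idealMl => //; apply: Kx.
Qed.

Lemma killersK I M s k i u x : prime_ideal M -> ~ M u ->
  killers I M s k i (u * x) -> killers I M s k i x.
Proof.
by move=> prM Mu Kx b /Kx; rewrite -mulrA; apply: satK.
Qed.

Hypothesis gaussR : gaussian R.

(* Replace the factor [b i] by its multiple of [a]: the difference annihilates
   everything dominated by [a], hence [s l]. *)
Lemma killers_sub I M s k i i' l a : is_ideal I -> prime_ideal M ->
    i != k -> i' != k -> l != i -> l != i' -> a \in s i' ->
    (forall c, c \in s i -> dominates M a c) ->
    (forall c, c \in s l -> dominates M a c) ->
  span (s k) `&` killers I M s k i `<=` killers I M s k i'.
Proof.
move=> idI prM ik i'k li li' sa ai al x [sx Kx] b sb.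
have idS := is_ideal_sat idI prM.
have [ii'|ii'] := eqVneq i i'; first by rewrite -ii'; apply: Kx.
have [u [t [n [Mu uE nE]]]] := dominates_decomp_null gaussR prM (ai _ (sb i)).
have satn c : c \in s l -> sat I M (n * c).
  move=> /al/nE[v Mv vE]; exists v => //; rewrite vE; exact: ideal0.
set P := fun j => [&& j != i', j != k & j != i].
set Q := \prod_(j | P j) b j.
have -> : \prod_(j | (j != i') && (j != k)) b j = b i * Q.
  rewrite (bigD1 i) /=; last by rewrite ii' ik.
  by congr (_ * _); apply: eq_bigl => j; rewrite /P andbA.
apply: (satK prM Mu).
have -> : u * (x * (b i * Q)) = t * (x * (a * Q)) + n * x * Q.
  have -> : u * (x * (b i * Q)) = u * b i * x * Q by ring.
  rewrite uE; ring.
apply: idealD => //.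
  apply: idealMl => //.
  have -> : a * Q = \prod_(j | (j != i) && (j != k)) upd b i' a j.
    rewrite prod_upd; last by rewrite eq_sym ii' i'k.
    by congr (_ * _); apply: eq_bigl => j; rewrite /P [RHS]andbC [in RHS]andbC -!andbA;
      case: (j != i'); case: (j != k); case: (j != i).
  exact/Kx/choice_upd.
(* The remainder [n x Q] lies locally in [I], as [n] kills [s l]: either [l = k] and [x] is in the
   span of [s l], or [b l] is a factor of [Q]. *)
have [lk|lk] := eqVneq l k.
  apply: idealMr => //; rewrite -lk in sx.
  suff: [set x | sat I M (n * x)] x by [].
  apply: (span_sub _ satn) sx; split=> /=.
  - by rewrite mulr0; apply: ideal0.
  - by move=> y z ny nz; rewrite mulrDr; apply: idealD.
  - by move=> c y ny; rewrite mulrCA; apply: idealMl.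
have -> : n * x * Q = x * \prod_(j | P j && (j != l)) b j * (n * b l).
  by rewrite /Q (bigD1 l) /=; [ring|rewrite /P li' lk li].
by apply: idealMl => //; apply: satn.
Qed.

(* Let [l] be the least dominant index at [M].  The conditions with [i != l]
   form a chain, by [killers_sub], so that only two conditions matter. *)
Lemma local_avoidance I M s k : is_ideal I -> prime_ideal M ->
    (forall j, s j <> [::]) ->
  exists2 x, span (s k) x & forall i, i != k ->
    ~ (span (s k) `<=` killers I M s k i) -> avoids (s k) M (killers I M s k i) x.
Proof.
move=> idI prM nes; have [idM M1 _] := prM.
pose dom := dominates M.
have domT := dominates_total gaussR prM; have domt := dominates_trans gaussR prM.
have [a aP] : {a : T -> R & forall j, a j \in s j /\ forall c, c \in s j -> dom (a j) c}.
  apply: (@choice _ _ (fun j c => c \in s j /\ forall d, d \in s j -> dom c d)) => j.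
  by have [c sc cmax] := exists_dominant domT domt (nes j); exists c.
have enumN0 : enum T <> [::] by move=> e0; have := mem_enum T k; rewrite e0.
(* The order is reversed here: every [a j] dominates [a l]. *)
have [l _ lmin] := @exists_dominant _ (fun i j => dom (a j) (a i)) _
  (fun i j => domT (a j) (a i)) (fun i j m ij jm => domt _ _ _ jm ij) enumN0.
have idK i := is_ideal_killers s k i idI prM.
have Ksat i u x := @killersK I M s k i u x prM.
pose good i := [/\ i != k, l != i & ~ (span (s k) `<=` killers I M s k i)].
suff [x [sx xl xgood]] : exists x, [/\ span (s k) x,
    ~ (span (s k) `<=` killers I M s k l) -> avoids (s k) M (killers I M s k l) x &
    forall i, good i -> avoids (s k) M (killers I M s k i) x].
  exists x => // i ik nsub; have [li|li] := eqVneq l i; last exact: xgood.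
  by rewrite -li in nsub *; apply: xl.
have [x1 sx1 x1l] : exists2 x, span (s k) x &
    ~ (span (s k) `<=` killers I M s k l) -> avoids (s k) M (killers I M s k l) x.
  have [sub|nsub] := pselect (span (s k) `<=` killers I M s k l).
    by exists 0 => //; apply: (ideal0 (is_ideal_lincomb (s k) (@idealT R))).
  by have [x sx xl] := exists_avoids (idK l) prM (Ksat l) nsub; exists x.
have [e0|neS] := pselect ([seq i <- enum T | `[< good i >]] = [::]).
  exists x1; split=> // i /asboolP good_i.
  suff: i \in [seq i <- enum T | `[< good i >]] by rewrite e0.
  by rewrite mem_filter good_i mem_enum.
have [i0] := @exists_dominant _ (fun i j => dom (a i) (a j)) _
  (fun i j => domT (a i) (a j)) (fun i j m => @domt _ _ _) neS.
rewrite mem_filter => /andP[/asboolP[i0k li0 nsub] _] i0max.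
have [x2 sx2 x2i0] := exists_avoids (idK i0) prM (Ksat i0) nsub.
have dommax j c : dom (a i0) (a j) -> c \in s j -> dom (a i0) c.
  by move=> /domt ij sc; apply/ij/(proj2 (aP j)).
(* As [a i0] dominates at all good indices, the killers at [i0] have the largest trace on the span
   of [s k] among them. *)
have avoidsP x : avoids (s k) M (killers I M s k i0) x ->
    forall i, good i -> avoids (s k) M (killers I M s k i) x.
  move=> xi0 i good_i y sy Ly Ky; apply: (xi0 y sy Ly).
  have [ik li _] := good_i.
  apply: (@killers_sub I M s k i i0 l (a i0)) => //.
  - by case: (aP i0).
  - by move=> c; apply: dommax; apply: i0max; rewrite mem_filter mem_enum andbT; apply/asboolP.
  - by move=> c; apply: dommax; apply: lmin; rewrite mem_enum.
have [sub|nsubl] := pselect (span (s k) `<=` killers I M s k l).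
  by exists x2; split=> //; apply: avoidsP.
have [x [sx xl xi0]] := exists_avoids2 idM (idK l) (idK i0) sx1 (x1l nsubl) sx2 x2i0.
by exists x; split=> //; apply: avoidsP.
Qed.

(* [Ms i] is a maximal ideal over the annihilator modulo [I] of a nonzero product
   without the factor of index [i]; the [Ms i] are finitely many, so that an element
   avoiding the bad submodules at each of them exists by the Chinese remainder
   theorem. *)
Lemma replace_by_element I s k : is_ideal I ->
    (forall i, exists2 b, choice_of s b & ~ I (\prod_(j | j != i) b j)) ->
  exists2 x, span (s k) x & forall i, i != k ->
    exists2 b, choice_of s b & ~ I (x * \prod_(j | (j != i) && (j != k)) b j).
Proof.
move=> idI nz.
have nes j : s j <> [::].
  by have [b sb _] := nz k => sj0; have := sb j; rewrite sj0.
have [b bP] : {b : T -> T -> R &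
    forall i, choice_of s (b i) /\ ~ I (\prod_(j | j != i) b i j)}.
  by apply: (@choice _ _ (fun i c => choice_of s c /\ ~ I (\prod_(j | j != i) c j)))
    => i; have [c sc nc] := nz i; exists c.
have [Ms MsP] : {Ms : T -> set R & forall i, maximal_ideal (Ms i) /\
    forall u, I (u * \prod_(j | j != i) b i j) -> Ms i u}.
  apply: (@choice _ _ (fun i M => maximal_ideal M /\
    forall u, I (u * \prod_(j | j != i) b i j) -> M u)) => i.
  set p := \prod_(j | j != i) b i j.
  have [||M [maxM subM]] := @exists_maximal_ideal R [set u | I (u * p)].
  - split=> /= [|x y Ix Iy|c x Ix].
    + by rewrite mul0r; apply: ideal0.
    + by rewrite mulrDl; apply: idealD.
    + by rewrite -mulrA; apply: idealMl.
  - by rewrite /= mul1r; case: (bP i).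
  - by exists M; split=> // u Iu; apply: subM.
pose P M x := forall i, i != k -> ~ (span (s k) `<=` killers I M s k i) ->
  avoids (s k) M (killers I M s k i) x.
have maxMs M : M \in map Ms (enum T) -> maximal_ideal M.
  by move=> /mapP[i _ ->]; case: (MsP i).
have [|M x y MsM sx sy Lxy Px i ik nsub z sz Lz|x sx Px] := crt_choice (P := P) (s := s k) maxMs.
- by move=> M /maxMs/maximal_prime prM; apply: local_avoidance.
- apply: (Px i ik nsub z sz).
  have -> : x - z = (x - y) + (y - z) by ring.
  by apply: idealD => //; apply: is_ideal_lincomb; case: (maxMs M MsM).
exists x => // i ik; apply: contrapT => noP.
have [maxM subM] := MsP i; have prM := maximal_prime maxM.
have [idM _ _] := maxM; have idL := is_ideal_lincomb (s k) idM.
have MsMi : Ms i \in map Ms (enum T) by apply: map_f; rewrite mem_enum.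
(* By [noP], [x] is itself a killer, against avoidance. The condition at [i] is not void: otherwise
   some [u] outside [Ms i] would kill the product of the [b i j] modulo [I]. *)
apply: (Px (Ms i) MsMi i ik _ x sx).
- move=> sub; have [sb nb] := bP i.
  have [u Mu Iu] : sat I (Ms i) (\prod_(j | j != i) b i j).
    rewrite (bigD1 k) /=; last by rewrite eq_sym.
    by apply: sub; [apply: mem_span|].
  by apply: Mu; apply: subM.
- by rewrite subrr; apply: ideal0.
- move=> c sc; apply: sub_sat => //; apply: contrapT => nc.
  by apply: noP; exists c.
Qed.

(** With [n.+1] indices, this turns a failure of [n]-absorption for finitely generated ideals into
    one for elements; the lists become singletons one after the other. *)
Lemma exists_elements I s : is_ideal I ->
    (forall b, choice_of s b -> I (\prod_j b j)) ->
    (forall i, exists2 b, choice_of s b & ~ I (\prod_(j | j != i) b j)) ->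
  exists x : T -> R, I (\prod_j x j) /\ forall i, ~ I (\prod_(j | j != i) x j).
Proof.
move=> idI zs nzs.
have [s' [s'1 zs' nzs']] : exists s', [/\ forall k, k \in enum T -> exists x, s' k = [:: x],
    forall b, choice_of s' b -> I (\prod_j b j) &
    forall i, exists2 b, choice_of s' b & ~ I (\prod_(j | j != i) b j)].
  elim: (enum T) => [|k ks [s' [s'1 zs' nzs']]]; first by exists s.
  have [x sx xP] := replace_by_element k idI nzs'.
  exists (fun j => if j == k then [:: x] else s' j); split.
  - move=> j; rewrite inE; case: eqP => [_ _|_ /s'1//]; by exists x.
  - move=> b sb; rewrite (bigD1 k) //=.
    have := sb k; rewrite eqxx mem_seq1 => /eqP->.
    set Q := \prod_(j | j != k) b j.
    (* This set is an ideal containing the list [s' k], hence also its combination [x]. *)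
    suff: [set y | I (y * Q)] x by [].
    have [b0 sb0 _] := nzs' k.
    apply: (span_sub _ _ sx) => [|c sc /=].
      split=> /= [|y z Iy Iz|c y Iy].
      + by rewrite mul0r; apply: ideal0.
      + by rewrite mulrDl; apply: idealD.
      + by rewrite -mulrA; apply: idealMl.
    rewrite /Q -(@prod_upd b k c xpredT) //; apply: zs' => j.
    rewrite /upd; case: eqP => [->//|/eqP/negPf jk].
    by have := sb j; rewrite jk.
  - move=> i.
    have upd_choice b : choice_of s' b ->
        choice_of (fun j => if j == k then [:: x] else s' j) (upd b k x).
      by move=> sb j; rewrite /upd; case: eqP => // _; rewrite mem_seq1.
    have [->|ik] := eqVneq i k.
      have [b sb nb] := nzs' k; exists (upd b k x); first exact: upd_choice.
      by rewrite prod_updN // eqxx.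
    have [b sb nb] := xP i ik; exists (upd b k x); first exact: upd_choice.
    by rewrite prod_upd // eq_sym.
have [x xE] : {x : T -> R & forall k, s' k = [:: x k]}.
  by apply: (@choice _ _ (fun k y => s' k = [:: y])) => k; apply: s'1; rewrite mem_enum.
have s'x b : choice_of s' b -> b = x.
  by move=> sb; apply/funext => j; have := sb j; rewrite xE mem_seq1 => /eqP.
exists x; split; first by apply: zs' => j; rewrite xE mem_head.
by move=> i; have [b /s'x-> nb] := nzs' i.
Qed.

End Families.

Lemma omega_eq (R S : comNzRingType) (I : set R) (J : set S) :
    (I = setT <-> J = setT) -> (forall n, n_absorbing n I <-> n_absorbing n J) ->
  omega I = omega J.
Proof.
move=> IJT IJn; rewrite /omega.
case: (pselect (I = setT)) => IT; case: (pselect (J = setT)) => JT //=.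
- by case: JT; apply/IJT.
- by case: IT; apply/IJT.
case: (pselect (exists n, `[< n_absorbing n I >])) => [exI|nexI];
  case: (pselect (exists n, `[< n_absorbing n J >])) => [exJ|nexJ] //.
- by congr Some; apply: eq_ex_minn => n; apply/asboolP/asboolP => /IJn.
- by case: nexJ; case: exI => n /asboolP/IJn nJ; exists n; apply/asboolP.
- by case: nexI; case: exJ => n /asboolP/IJn nI; exists n; apply/asboolP.
Qed.

(** * The ideal [I[X]] and coefficients of products *)

Section PolyIdeal.
Variables (R : comNzRingType) (I : set R).
Hypothesis idI : is_ideal I.
Implicit Types (f g : {poly R}).

Lemma is_ideal_poly_ideal : is_ideal (poly_ideal I).
Proof.
split=> [i|f g If Ig i|f g Ig i].
- by rewrite coef0; apply: ideal0.
- by rewrite coefD; apply: idealD.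
- by rewrite coefM; apply: ideal_sum => // j _; apply: idealMl.
Qed.

Lemma poly_idealC (x : R) : poly_ideal I x%:P <-> I x.
Proof.
split=> [/(_ 0%N)|Ix i]; rewrite coefC //.
by case: eqP => // _; apply: ideal0.
Qed.

Lemma poly_ideal_setT : poly_ideal I = setT <-> I = setT.
Proof.
split=> [IT|->]; last exact/seteqP.
by apply/seteqP; split=> // x _; apply/poly_idealC; rewrite IT.
Qed.

(* The zero added to the coefficients makes the list nonempty. *)
Definition coefs f : seq R := 0 :: f.

Lemma coef_coefs f i : f`_i \in coefs f.
Proof.
rewrite inE; have [lt|le] := ltnP i (size f); first by rewrite mem_nth ?orbT.
by rewrite nth_default // eqxx.
Qed.

Lemma coefsP f x : x \in coefs f -> content f x.
Proof.
rewrite inE => /orP[/eqP->|/(nthP 0)[i _ <-]]; first exact: (ideal0 (is_ideal_gen _)).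
by apply: sub_ideal_gen; exists i.
Qed.

Lemma poly_ideal_prod (T : finType) (f : T -> {poly R}) (P : pred T) :
    (forall b, choice_of (fun j => coefs (f j)) b -> I (\prod_(j | P j) b j)) ->
  poly_ideal I (\prod_(j | P j) f j).
Proof.
(* The scalar [y] gathers the coefficients already picked; [uniq] keeps an update at one index from
   touching the later factors. *)
suff gen r y : uniq r ->
    (forall b, choice_of (fun j => coefs (f j)) b -> I (y * \prod_(j <- r) b j)) ->
    poly_ideal I (y%:P * \prod_(j <- r) f j).
  move=> Ib; rewrite -[\prod_(_ | _) _]mul1r -[X in X * _]polyC1 -big_filter.
  apply: gen => [|b /Ib]; first exact/filter_uniq/index_enum_uniq.
  by rewrite mul1r big_filter.
elim: r y => [|k r IHr] y /=.
  move=> _ Ib; rewrite big_nil mulr1; apply/poly_idealC.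
  have := Ib (fun=> 0); rewrite big_nil mulr1; apply => j.
  exact: mem_head.
move=> /andP[kr ur] Ib i; rewrite big_cons coefCM coefM mulr_sumr.
apply: ideal_sum => // a _; rewrite mulrA -coefCM; apply: IHr => // b fb.
have := Ib (upd b k (f k)`_a).
have -> : \prod_(j <- k :: r) upd b k (f k)`_a j = (f k)`_a * \prod_(j <- r) b j.
  rewrite big_cons {1}/upd eqxx; congr (_ * _); apply: eq_big_seq => j rj.
  by rewrite /upd; case: eqP => // jk; rewrite -jk rj in kr.
rewrite mulrA; apply; apply: choice_upd => //; apply: coef_coefs.
Qed.

End PolyIdeal.

(** * Transfer of absorption between [I] and [I[X]] *)

Lemma prod_content (R : comNzRingType) (T : finType) (f : T -> {poly R})
    (b : T -> R) (P : pred T) : gaussian R ->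
  (forall j, content (f j) (b j)) ->
  content (\prod_(j | P j) f j) (\prod_(j | P j) b j).
Proof.
move=> gaussR fb; apply: (big_rec2 (fun x f => content f x)).
  by apply: sub_ideal_gen; exists 0%N; rewrite coef1.
by move=> j x g _ gx; rewrite gaussR; apply: sub_ideal_gen; exists (b j), x.
Qed.

Theorem corollary13 (R : comNzRingType) (gaussR : gaussian R)
    (tfR : torsion_free R) (I : set R) (idI : is_ideal I) :
  omega (poly_ideal I) = omega I.
Proof.
apply: omega_eq => [|n]; first exact: poly_ideal_setT.
have idX := is_ideal_poly_ideal idI.
split=> [[_ nT n0 abs]|[_ nT n0 abs]]; split=> //.
- by move=> IT; apply: nT; apply/poly_ideal_setT.
(* Constant polynomials carry absorption from [I[X]] down to [I]. *)
- move=> x Ix; have [|A [cardA]] := abs (fun i => (x i)%:P).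
    by rewrite -rmorph_prod; apply/poly_idealC.
  by rewrite -rmorph_prod => /(poly_idealC idI) IA; exists A.
- by move=> /(poly_ideal_setT idI).
move=> f If; apply: contrapT => noA.
(* The Gaussian property puts all products of coefficients of the [f j] in [I]; the failure for [f]
   thus yields elements [x] of [R] that contradict absorption by [I]. *)
have [|i|x [Ix nIx]] := @exists_elements R 'I_n.+1 gaussR I (fun j => coefs (f j)) idI.
- move=> b fb.
  have : content (\prod_j f j) `<=` I by apply: ideal_gen_sub => // _ [i ->].
  by apply; apply: prod_content => // j; apply: coefsP.
- apply: contrapT => nob; apply: noA; exists (~: [set i])%SET.
  split; first by rewrite cardsC1 card_ord.
  rewrite (eq_bigl (fun j => j != i)); last by move=> j; rewrite !inE.
  apply: poly_ideal_prod => // b fb; apply: contrapT => nIb.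
  by apply: nob; exists b.
have [A [cardA IA]] := abs x Ix.
have /cards1P[i AE] : #|(~: A)%SET| == 1%N.
  by rewrite cardsCs finset.setCK card_ord cardA subSnn.
apply: (nIx i); rewrite (eq_bigl (fun j => j \in A)) // => j.
by rewrite -[RHS]negbK -finset.in_setC AE finset.in_set1.
Qed.
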